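(* Let $0<\phi_0<\phi_1<\frac{\pi}{2}$ and let $T^*:=3T(\phi_1)-T_1(\phi_1,\phi_0)$. Then for every $\alpha\in\left(\phi_1,\frac{\pi}{2}\right)$, $$T_D(\alpha):=4T(\alpha)-T_1(\alpha,\phi_0)-T_1(\alpha,\phi_1)>T^*.$$
   Context: For $\alpha\in(0,\frac{\pi}{2})$ define $T(\alpha):=\int_0^{\alpha}\frac{dx}{\sqrt{\cos 2x-\cos 2\alpha}}$, and for $0<\phi\le\alpha$ define $T_1(\alpha,\phi):=\int_0^{\phi}\frac{dx}{\sqrt{\cos 2x-\cos 2\alpha}}$ (these are convergent, possibly improper, integrals; $T_1(\alpha,\alpha)=T(\alpha)$). *)

(* Defs.v *)
From Stdlib Require Import Reals.
From Coquelicot Require Import Coquelicot.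
Open Scope R_scope.

Definition integrand (alpha x : R) : R :=
  / sqrt (cos (2 * x) - cos (2 * alpha)).

(* The upper endpoint is approached from the left because the integrand is
   unbounded at [alpha]: [T1 alpha alpha] is an improper integral, while for
   [0 < phi < alpha < PI / 2] the value is that of the ordinary Riemann
   integral. *)
Definition T1 (alpha phi : R) : R :=
  RInt_gen (integrand alpha) (at_point 0) (at_left phi).

Definition T (alpha : R) : R :=
  RInt_gen (integrand alpha) (at_point 0) (at_left alpha).

Definition T_star (phi0 phi1 : R) : R :=
  3 * T phi1 - T1 phi1 phi0.

Definition T_D (phi0 phi1 alpha : R) : R :=
  4 * T alpha - T1 alpha phi0 - T1 alpha phi1.

(* Main.v *)
Require Import Defs.
From Stdlib Require Import Reals Lra.
From Coquelicot Require Import Coquelicot.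
Open Scope R_scope.

(** Two monotonicity facts give the inequality.  For a fixed upper limit, the
    integrand decreases as [alpha] grows, so [T1 alpha phi0] is at most
    [T1 phi1 phi0] ([T1_decreasing]); the complete integral [T] grows with
    [alpha] ([T_increasing]); and [T1 alpha phi1 < T alpha] because the
    integrand is positive ([T1_lt_T]).  Hence
    [[
      4 T(alpha) - T1(alpha, phi0) - T1(alpha, phi1)
        > 3 T(alpha) - T1(alpha, phi0) >= 3 T(phi1) - T1(phi1, phi0).
    ]]
    The growth of [T] is not visible on its definition: the integrand shrinks
    while the interval widens, and the integral is improper.  Since
    [cos 2x - cos 2 alpha = 2 (sin^2 alpha - sin^2 x)], the substitution
    [sin x = sin alpha * sin theta] turns [T1 alpha phi] into Legendre's
    incomplete elliptic integral of the first kind, with modulus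
    [k = sin alpha] and continuous integrand
    [1 / sqrt (1 - k^2 sin^2 theta)], up to a factor [1 / sqrt 2]
    ([T1_elliptic]).  The endpoint [phi = alpha] corresponds to the fixed limit
    [theta = PI / 2], so that [T] inherits from this integrand its growth
    in [k].  The same formula also shows that the improper integrals
    converge. *)

(** * Elliptic integrals of the first kind *)

Definition first_kind (k t : R) : R := / sqrt (1 - (k * sin t) ^ 2).

Definition elliptic_F (k theta : R) : R := RInt (first_kind k) 0 theta.

(** The angle [theta] for which [sin x = sin alpha * sin theta]. *)
Definition amplitude (alpha x : R) : R := asin (sin x / sin alpha).

Lemma first_kind_arg_pos (k t : R) : 0 <= k < 1 -> 0 < 1 - (k * sin t) ^ 2.
Proof.
  intros Hk.
  assert (Ht := sin2_cos2 t); unfold Rsqr in Ht.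
  assert (Hc := pow2_ge_0 (cos t)); assert (Hs := pow2_ge_0 (sin t)).
  assert (k ^ 2 < 1) by nra.
  rewrite Rpow_mult_distr; nra.
Qed.

Lemma first_kind_pos (k t : R) : 0 <= k < 1 -> 0 < first_kind k t.
Proof.
  intros Hk; apply Rinv_0_lt_compat, sqrt_lt_R0.
  now apply first_kind_arg_pos.
Qed.

Lemma first_kind_continuous (k t : R) :
  0 <= k < 1 -> continuous (first_kind k) t.
Proof.
  intros Hk; assert (Hp := first_kind_arg_pos k t Hk).
  apply (ex_derive_continuous (first_kind k)); unfold first_kind.
  auto_derive; repeat split; try lra.
  apply Rgt_not_eq, sqrt_lt_R0; lra.
Qed.

Lemma first_kind_integrable (k a b : R) :
  0 <= k < 1 -> ex_RInt (first_kind k) a b.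
Proof.
  intros Hk; apply (ex_RInt_continuous (first_kind k)).
  intros t _; now apply first_kind_continuous.
Qed.

Lemma elliptic_F_derive (k theta : R) :
  0 <= k < 1 -> is_derive (elliptic_F k) theta (first_kind k theta).
Proof.
  intros Hk; apply is_derive_RInt with 0.
  - apply filter_forall; intros b.
    now apply (RInt_correct (first_kind k)), first_kind_integrable.
  - now apply first_kind_continuous.
Qed.

Lemma elliptic_F_lt (k a b : R) :
  0 <= k < 1 -> a < b -> elliptic_F k a < elliptic_F k b.
Proof.
  intros Hk Hab.
  assert (H : plus (elliptic_F k a) (RInt (first_kind k) a b) = elliptic_F k b)
    by (apply (RInt_Chasles (first_kind k)); now apply first_kind_integrable).
  change (elliptic_F k a + RInt (first_kind k) a b = elliptic_F k b) in H.
  assert (0 < RInt (first_kind k) a b); [ | lra].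
  apply RInt_gt_0; trivial; intros t _.
  - now apply first_kind_pos.
  - now apply first_kind_continuous.
Qed.

Lemma elliptic_F_le_modulus (k l theta : R) :
  0 <= k <= l -> l < 1 -> 0 <= theta -> elliptic_F k theta <= elliptic_F l theta.
Proof.
  intros Hkl Hl Ht.
  apply RInt_le; trivial; try (apply first_kind_integrable; lra).
  intros t _.
  assert (0 < 1 - (l * sin t) ^ 2) by (apply first_kind_arg_pos; lra).
  apply Rinv_le_contravar; [now apply sqrt_lt_R0 | apply sqrt_le_1_alt].
  assert (Hs := pow2_ge_0 (sin t)).
  assert (k ^ 2 <= l ^ 2) by (apply pow_incr; lra).
  rewrite !Rpow_mult_distr; nra.
Qed.

(** * The amplitude *)

Lemma sin_acute (alpha : R) : 0 < alpha < PI / 2 -> 0 < sin alpha < 1.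
Proof.
  intros Ha; split; [apply sin_gt_0; lra | ].
  rewrite <- sin_PI2; apply sin_increasing_1; lra.
Qed.

Lemma sin_ratio_bounds (alpha x : R) :
  0 <= x < alpha -> alpha < PI / 2 -> 0 <= sin x / sin alpha < 1.
Proof.
  intros Hx Ha.
  assert (0 < sin alpha < 1) by (apply sin_acute; lra).
  assert (0 <= sin x) by (apply sin_ge_0; lra).
  assert (sin x < sin alpha) by (apply sin_increasing_1; lra).
  split.
  - apply Rmult_le_pos; [ | apply Rlt_le, Rinv_0_lt_compat]; lra.
  - apply Rlt_div_l; lra.
Qed.

Lemma asin_is_derive (s : R) :
  -1 < s < 1 -> is_derive asin s (/ sqrt (1 - s ^ 2)).
Proof.
  intros Hs; apply is_derive_Reals.
  replace (/ sqrt (1 - s ^ 2)) with (1 / sqrt (1 - s²))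
    by (unfold Rsqr, Rdiv; rewrite Rmult_1_l; do 3 f_equal; ring).
  rewrite <- (derive_pt_asin s Hs).
  exact (proj2_sig (derivable_pt_asin s Hs)).
Qed.

Lemma amplitude_derive (alpha x : R) :
  0 <= x < alpha -> alpha < PI / 2 ->
  is_derive (amplitude alpha) x
    (cos x / sin alpha * / sqrt (1 - (sin x / sin alpha) ^ 2)).
Proof.
  intros Hx Ha.
  assert (Hs := sin_ratio_bounds alpha x Hx Ha).
  assert (0 < sin alpha < 1) by (apply sin_acute; lra).
  apply (is_derive_comp asin (fun y => sin y / sin alpha)).
  - apply asin_is_derive; lra.
  - auto_derive; trivial; field; lra.
Qed.

Lemma amplitude_self (alpha : R) : sin alpha <> 0 -> amplitude alpha alpha = PI / 2.
Proof.
  intros Ha; unfold amplitude, Rdiv.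
  rewrite Rinv_r by trivial; apply asin_1.
Qed.

Lemma amplitude_acute (alpha x : R) :
  0 <= x < alpha -> alpha < PI / 2 -> amplitude alpha x < PI / 2.
Proof.
  intros Hx Ha; assert (Hs := sin_ratio_bounds alpha x Hx Ha).
  apply asin_bound_lt; lra.
Qed.

(** Below [alpha] the amplitude is differentiable.  At [alpha] it has an infinite
    slope, and its limit [PI / 2] comes from monotonicity instead: an amplitude
    at most [b < PI / 2] would force [sin x <= sin alpha * sin b], which fails
    for [x] close to [alpha]. *)
Lemma amplitude_left_limit (alpha phi : R) :
  0 < phi <= alpha -> alpha < PI / 2 ->
  filterlim (amplitude alpha) (at_left phi) (locally (amplitude alpha phi)).
Proof.
  intros Hp Ha; assert (Hk : 0 < sin alpha < 1) by (apply sin_acute; lra).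
  destruct (Rle_lt_or_eq_dec phi alpha (proj2 Hp)) as [Hlt | ->].
  - apply (filterlim_filter_le_1 _ (filter_le_within (F := locally phi) _)).
    apply (ex_derive_continuous (amplitude alpha)).
    eexists; apply amplitude_derive; lra.
  - rewrite amplitude_self by lra.
    intros P [eps HP].
    assert (Heps := cond_pos eps); assert (Hpi := PI_RGT_0).
    (* The maximum with 0 keeps [b] where the sine is increasing,
       even for large [eps]. *)
    set (b := Rmax 0 (PI / 2 - eps / 2)).
    assert (Hb : 0 <= b < PI / 2 /\ PI / 2 - eps / 2 <= b)
      by (unfold b, Rmax; destruct Rle_dec; lra).
    assert (Hsb : sin b < 1) by (rewrite <- sin_PI2; apply sin_increasing_1; lra).
    assert (Hnear : locally alpha (fun x => sin alpha * sin b < sin x)).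
    { apply (continuous_sin alpha (fun y => sin alpha * sin b < y)).
      apply open_gt; nra. }
    assert (Hpos : locally alpha (fun x => 0 < x)) by (apply open_gt; lra).
    unfold filtermap, at_left, within.
    generalize (filter_and _ _ Hnear Hpos); apply filter_imp.
    intros x [Hx H0] Hxa; apply HP.
    assert (Hs : 0 <= sin x / sin alpha < 1) by (apply sin_ratio_bounds; lra).
    assert (Hlt : amplitude alpha x < PI / 2) by (apply amplitude_acute; lra).
    assert (Hgt : b < amplitude alpha x).
    { apply sin_increasing_0; try lra.
      - apply asin_bound.
      - unfold amplitude; rewrite sin_asin by lra.
        apply Rlt_div_r; lra. }
    change (Rabs (amplitude alpha x - PI / 2) < eps).
    rewrite Rabs_left; lra.
Qed.

(** * Reduction of the improper integrals *)

Lemma integrand_arg (alpha x : R) :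
  cos (2 * x) - cos (2 * alpha) = 2 * (sin alpha ^ 2 - sin x ^ 2).
Proof. rewrite !cos_2a_sin; ring. Qed.

Lemma integrand_arg_pos (alpha x : R) :
  0 <= x < alpha -> alpha < PI / 2 -> 0 < cos (2 * x) - cos (2 * alpha).
Proof.
  intros Hx Ha.
  assert (cos (2 * alpha) < cos (2 * x)) by (apply cos_decreasing_1; lra).
  lra.
Qed.

Lemma integrand_continuous (alpha x : R) :
  0 <= x < alpha -> alpha < PI / 2 -> continuous (integrand alpha) x.
Proof.
  intros Hx Ha; assert (Hp := integrand_arg_pos alpha x Hx Ha).
  apply (ex_derive_continuous (integrand alpha)); unfold integrand.
  auto_derive; repeat split; try lra.
  apply Rgt_not_eq, sqrt_lt_R0; lra.
Qed.

(** The change of variable, as a derivative.  With [theta] the amplitude of [x],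
    [d theta / dx = cos x / (sin alpha * cos theta)]; the elliptic integrand at
    [theta] is [1 / cos x], as [sin alpha * sin theta = sin x]; and
    [sin alpha * cos theta = sqrt (sin^2 alpha - sin^2 x)]. *)
Lemma elliptic_primitive (alpha x : R) :
  0 <= x < alpha -> alpha < PI / 2 ->
  is_derive (fun y => elliptic_F (sin alpha) (amplitude alpha y) / sqrt 2) x
    (integrand alpha x).
Proof.
  intros Hx Ha.
  assert (Hk : 0 < sin alpha < 1) by (apply sin_acute; lra).
  assert (Hs := sin_ratio_bounds alpha x Hx Ha).
  assert (Hc : 0 < cos x) by (apply cos_gt_0; lra).
  assert (Hq : 0 < 1 - (sin x / sin alpha) ^ 2) by nra.
  assert (Hd : is_derive (fun y => elliptic_F (sin alpha) (amplitude alpha y)) x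
    (cos x / sin alpha * / sqrt (1 - (sin x / sin alpha) ^ 2)
       * first_kind (sin alpha) (amplitude alpha x))).
  { apply (is_derive_comp (elliptic_F (sin alpha)) (amplitude alpha)).
    - apply elliptic_F_derive; lra.
    - now apply amplitude_derive. }
  replace (integrand alpha x) with
    (/ sqrt 2 * (cos x / sin alpha * / sqrt (1 - (sin x / sin alpha) ^ 2)
       * first_kind (sin alpha) (amplitude alpha x))).
  - apply (is_derive_ext
      (fun y => / sqrt 2 * elliptic_F (sin alpha) (amplitude alpha y))).
    { intros y; apply Rmult_comm. }
    now apply (is_derive_scal
      (fun y => elliptic_F (sin alpha) (amplitude alpha y))).
  - unfold integrand, first_kind, amplitude.
    rewrite sin_asin by lra.
    replace (1 - (sin alpha * (sin x / sin alpha)) ^ 2) with (cos x ^ 2)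
      by (assert (H := sin2_cos2 x); unfold Rsqr in H; field_simplify; lra).
    rewrite sqrt_pow2 by lra.
    replace (cos (2 * x) - cos (2 * alpha))
      with (2 * (sin alpha ^ 2 * (1 - (sin x / sin alpha) ^ 2)))
      by (rewrite integrand_arg; field; lra).
    rewrite sqrt_mult_alt by lra.
    rewrite sqrt_mult_alt by nra.
    rewrite sqrt_pow2 by lra.
    assert (0 < sqrt 2) by (apply sqrt_lt_R0; lra).
    assert (0 < sqrt (1 - (sin x / sin alpha) ^ 2)) by now apply sqrt_lt_R0.
    field; repeat split; lra.
Qed.

Lemma integrand_is_RInt (alpha x : R) :
  0 <= x < alpha -> alpha < PI / 2 ->
  is_RInt (integrand alpha) 0 x
    (elliptic_F (sin alpha) (amplitude alpha x) / sqrt 2).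
Proof.
  intros Hx Ha.
  replace (elliptic_F (sin alpha) (amplitude alpha x) / sqrt 2) with
    (minus (elliptic_F (sin alpha) (amplitude alpha x) / sqrt 2)
           (elliptic_F (sin alpha) (amplitude alpha 0) / sqrt 2)).
  - apply (is_RInt_derive
      (fun y => elliptic_F (sin alpha) (amplitude alpha y) / sqrt 2));
      rewrite Rmin_left, Rmax_right by lra; intros y Hy.
    + apply elliptic_primitive; lra.
    + apply integrand_continuous; lra.
  - unfold amplitude at 2, Rdiv at 3.
    rewrite sin_0, Rmult_0_l, asin_0; unfold elliptic_F at 2.
    rewrite RInt_point.
    unfold minus, plus, opp, zero; simpl; unfold Rdiv; ring.
Qed.

(** The proper integrals over [[0, b]] have this closed form in [b], which has a
    limit as [b] tends to [phi] from the left even when [phi = alpha].  This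
    single formula therefore covers the proper and the improper case. *)
Lemma T1_elliptic (alpha phi : R) :
  0 < phi <= alpha -> alpha < PI / 2 ->
  T1 alpha phi = elliptic_F (sin alpha) (amplitude alpha phi) / sqrt 2.
Proof.
  intros Hp Ha.
  assert (Hk : 0 < sin alpha < 1) by (apply sin_acute; lra).
  assert (Hlim : filterlim
    (fun x => elliptic_F (sin alpha) (amplitude alpha x) / sqrt 2)
    (at_left phi)
    (locally (elliptic_F (sin alpha) (amplitude alpha phi) / sqrt 2))).
  { apply (filterlim_comp _ _ _ (amplitude alpha)
      (fun theta => elliptic_F (sin alpha) theta / sqrt 2) _
      (locally (amplitude alpha phi))).
    - now apply amplitude_left_limit.
    - apply (continuous_mult (elliptic_F (sin alpha)) (fun _ => / sqrt 2)).
      + apply (ex_derive_continuous (elliptic_F (sin alpha))).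
        eexists; apply elliptic_F_derive; lra.
      + apply continuous_const. }
  apply is_RInt_gen_unique; intros P HP.
  apply (Filter_prod _ _ _ (fun a => a = 0)
    (fun b => (0 < b < phi) /\
       P (elliptic_F (sin alpha) (amplitude alpha b) / sqrt 2))).
  - reflexivity.
  - apply filter_and; [ | exact (Hlim P HP)].
    assert (Hpos : locally phi (fun x => 0 < x)) by (apply open_gt; lra).
    unfold at_left, within; revert Hpos; apply filter_imp; intros x H0 Hx; lra.
  - intros a b -> [Hb HPb]; eexists; split; [ | exact HPb].
    apply integrand_is_RInt; lra.
Qed.

Lemma T_elliptic (alpha : R) :
  0 < alpha < PI / 2 -> T alpha = elliptic_F (sin alpha) (PI / 2) / sqrt 2.
Proof.
  intros Ha; assert (Hk := sin_acute alpha Ha).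
  change (T alpha) with (T1 alpha alpha).
  rewrite T1_elliptic, amplitude_self by lra; reflexivity.
Qed.

(** * Monotonicity and the inequality *)

(** The elliptic form has the fixed range [[0, PI / 2]], on which the integrand
    grows with the modulus [sin alpha]. *)
Lemma T_increasing (alpha beta : R) :
  0 < alpha <= beta -> beta < PI / 2 -> T alpha <= T beta.
Proof.
  intros Hab Hb; rewrite !T_elliptic by lra.
  assert (Ha1 : 0 < sin alpha < 1) by (apply sin_acute; lra).
  assert (Hb1 : 0 < sin beta < 1) by (apply sin_acute; lra).
  assert (sin alpha <= sin beta) by (apply sin_incr_1; lra).
  apply Rmult_le_compat_r.
  - apply Rlt_le, Rinv_0_lt_compat, sqrt_lt_R0; lra.
  - apply elliptic_F_le_modulus; lra.
Qed.

Lemma T1_lt_T (alpha phi : R) :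
  0 < phi < alpha -> alpha < PI / 2 -> T1 alpha phi < T alpha.
Proof.
  intros Hp Ha; rewrite T_elliptic, T1_elliptic by lra.
  assert (Hk : 0 < sin alpha < 1) by (apply sin_acute; lra).
  apply Rmult_lt_compat_r.
  - apply Rinv_0_lt_compat, sqrt_lt_R0; lra.
  - apply elliptic_F_lt; [lra | apply amplitude_acute; lra].
Qed.

(** Here the original integrand is the useful one: in the elliptic form, the
    amplitude of [phi] falls while the modulus grows. *)
Lemma T1_decreasing (alpha beta phi : R) :
  0 < phi < alpha -> alpha <= beta -> beta < PI / 2 -> T1 beta phi <= T1 alpha phi.
Proof.
  intros Hp Hab Hb; rewrite !T1_elliptic by lra.
  apply (is_RInt_le (integrand beta) (integrand alpha) 0 phi); try lra;
    try (apply integrand_is_RInt; lra).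
  intros x Hx.
  assert (0 < cos (2 * x) - cos (2 * alpha)) by (apply integrand_arg_pos; lra).
  assert (cos (2 * beta) <= cos (2 * alpha)) by (apply cos_decr_1; lra).
  apply Rinv_le_contravar; [now apply sqrt_lt_R0 | apply sqrt_le_1_alt; lra].
Qed.

Theorem mainTheorem3 (phi0 phi1 : R)
  (hphi0 : 0 < phi0) (hphi01 : phi0 < phi1) (hphi1 : phi1 < PI / 2) :
  forall alpha : R, phi1 < alpha < PI / 2 ->
    T_D phi0 phi1 alpha > T_star phi0 phi1.
Proof.
  intros alpha Ha; unfold T_D, T_star.
  assert (T phi1 <= T alpha) by (apply T_increasing; lra).
  assert (T1 alpha phi1 < T alpha) by (apply T1_lt_T; lra).
  assert (T1 alpha phi0 <= T1 phi1 phi0) by (apply T1_decreasing; lra).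
  lra.
Qed.
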